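(* Let $\phi\colon\Omega\times\mathbb{R}^d\to\mathbb{R}\cup\{+\infty\}$ and $\psi\colon\Omega\times\mathbb{R}\to\mathbb{R}\cup\{+\infty\}$ be normal convex integrands for which the existence and strong duality assumption (see context) holds, with primal solution $u$ and dual solution $\mathbf{q}$. Suppose that both $\phi$ and $\psi$ satisfy the Bregman--Young inequality (see context). Then there is a constant $C>0$, depending only on the constant in the Bregman--Young inequality, such that for every $v\in W^{1,1}_D(\Omega)$, every $\mathbf{r}\in W^1_N(\mathrm{div};\Omega)$, and every element $T\in\mathcal{T}_h$, $$\eta_T^2(v,\mathbf{r})\le C\int_T\Big[\mathcal{D}_\phi(\nabla v,\nabla u)+\mathcal{D}_\psi(v,u)+\mathcal{D}_{\phi^*}(\mathbf{r},\mathbf{q})+\mathcal{D}_{\psi^*}(\mathrm{div}\,\mathbf{r},\mathrm{div}\,\mathbf{q})\Big],$$ where the inequality is understood in $[0,+\infty]$.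
   Context: **Domain and spaces.** $\Omega\subset\mathbb{R}^d$ is a bounded Lipschitz domain, triangulated by a conforming shape-regular triangulation $\mathcal{T}_h$. Its boundary is split into relatively open disjoint parts $\Gamma_D,\Gamma_N$ such that $\partial\Omega\setminus(\Gamma_D\cup\Gamma_N)$ has zero $(d-1)$-dimensional measure. For $p\in[1,\infty]$, $W^{1,p}_D(\Omega)$ is the set of $v\in W^{1,p}(\Omega)$ with zero trace on $\Gamma_D$. $W^1_N(\mathrm{div};\Omega)$ is the set of $\mathbf{r}\in L^1(\Omega)^d$ with $\mathrm{div}\,\mathbf{r}\in L^1(\Omega)$ and $\int_\Omega(\mathbf{r}\cdot\nabla w+w\,\mathrm{div}\,\mathbf{r})=0$ for all $w\in W^{1,\infty}_D(\Omega)$. **Integrands.** A normal convex integrand $\phi\colon\Omega\times\mathbb{R}^n\to\mathbb{R}\cup\{+\infty\}$ is a function that is convex (and proper) in the second variable and whose epigraphical mapping $x\mapsto\mathrm{epi}\,\phi(x,\cdot)$ is closed-valued and measurable. The conjugate $\phi^*$ and subdifferential $\partial\phi$ are taken with respect to the second variable. The effective domain of a convex function $h$ on $\mathbb{R}^n$ is $\mathrm{dom}\,h=\{h<+\infty\}$, and $\mathrm{dom}\,\partial h=\{\mathbf{a}:\partial h(\mathbf{a})\ne\emptyset\}$. **Energies and existence/strong duality assumption.** Let $$I(v)=\int_\Omega\phi(\cdot,\nabla v)+\int_\Omega\psi(\cdot,v),\qquad D(\mathbf{r})=-\int_\Omega\phi^*(\cdot,\mathbf{r})-\int_\Omega\psi^*(\cdot,\mathrm{div}\,\mathbf{r}).$$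 The assumption is that there exist $u\in W^{1,1}_D(\Omega)$ with $I(u)=\min_{W^{1,1}_D(\Omega)}I<+\infty$ (primal solution) and $\mathbf{q}\in W^1_N(\mathrm{div};\Omega)$ with $D(\mathbf{q})=\max_{W^1_N(\mathrm{div};\Omega)}D>-\infty$ (dual solution), and that $I(u)=D(\mathbf{q})$. In this setting the following optimality relations are satisfied a.e. in $\Omega$: $$\mathbf{q}\cdot\nabla u=\phi(\cdot,\nabla u)+\phi^*(\cdot,\mathbf{q}),\qquad u\,\mathrm{div}\,\mathbf{q}=\psi(\cdot,u)+\psi^*(\cdot,\mathrm{div}\,\mathbf{q}).$$ Equivalently, $\mathbf{q}\in\partial\phi(\cdot,\nabla u)$, $\nabla u\in\partial\phi^*(\cdot,\mathbf{q})$, $\mathrm{div}\,\mathbf{q}\in\partial\psi(\cdot,u)$, $u\in\partial\psi^*(\cdot,\mathrm{div}\,\mathbf{q})$ a.e. **Bregman divergences.** For a proper convex $h\colon\mathbb{R}^n\to\mathbb{R}\cup\{+\infty\}$, $\mathbf{b}\in\mathrm{dom}\,\partial h$ and $\mathbf{s}\in\partial h(\mathbf{b})$, set $\mathcal{D}_h^{\mathbf{s}}(\mathbf{a},\mathbf{b})=h(\mathbf{a})-h(\mathbf{b})-\mathbf{s}\cdot(\mathbf{a}-\mathbf{b})\in[0,+\infty]$. In the claim the following subgradients are used pointwise a.e.: $\mathcal{D}_\phi(\nabla v,\nabla u)=\mathcal{D}_\phi^{\mathbf{q}}(\nabla v,\nabla u)$, $\mathcal{D}_\psi(v,u)=\mathcal{D}_\psi^{\mathrm{div}\,\mathbf{q}}(v,u)$,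 $\mathcal{D}_{\phi^*}(\mathbf{r},\mathbf{q})=\mathcal{D}_{\phi^*}^{\nabla u}(\mathbf{r},\mathbf{q})$, $\mathcal{D}_{\psi^*}(\mathrm{div}\,\mathbf{r},\mathrm{div}\,\mathbf{q})=\mathcal{D}_{\psi^*}^{u}(\mathrm{div}\,\mathbf{r},\mathrm{div}\,\mathbf{q})$. **Bregman--Young inequality.** A proper convex lower semicontinuous $h\colon\mathbb{R}^n\to\mathbb{R}\cup\{+\infty\}$ satisfies the Bregman--Young inequality with constant $c>0$ if for all $\mathbf{a}_1\in\mathrm{dom}\,h$, $\mathbf{a}_2\in\mathrm{dom}\,\partial h$, $\mathbf{r}_1\in\mathrm{dom}\,h^*$, $\mathbf{r}_2\in\mathrm{dom}\,\partial h^*$ with $\mathbf{a}_2\in\partial h^*(\mathbf{r}_2)$, and all $\mathbf{p}\in\partial h(\mathbf{a}_2)$, $\mathbf{b}\in\partial h^*(\mathbf{r}_2)$, $$|(\mathbf{a}_1-\mathbf{a}_2)\cdot(\mathbf{r}_1-\mathbf{r}_2)|\le c\big(\mathcal{D}_h^{\mathbf{p}}(\mathbf{a}_1,\mathbf{a}_2)+\mathcal{D}_{h^*}^{\mathbf{b}}(\mathbf{r}_1,\mathbf{r}_2)\big).$$ An integrand $\phi$ (or $\psi$) satisfies it if $\phi(x,\cdot)$ (or $\psi(x,\cdot)$) does for a.e. $x\in\Omega$ with a constant $c$ independent of $x$. **Local gap estimator.** $$\eta_T^2(v,\mathbf{r})=\int_T\big[\phi(\cdot,\nabla v)-\mathbf{r}\cdot\nabla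 v+\phi^*(\cdot,\mathbf{r})\big]+\int_T\big[\psi(\cdot,v)-v\,\mathrm{div}\,\mathbf{r}+\psi^*(\cdot,\mathrm{div}\,\mathbf{r})\big].$$ By the Fenchel--Young inequality the integrands are pointwise non-negative (possibly $+\infty$). *)

(* Defs.v *)
From HB Require Import structures.
From mathcomp Require Import all_boot all_order all_algebra.
From mathcomp Require Import all_classical all_reals all_analysis.
Set Implicit Arguments.
Unset Strict Implicit.
Unset Printing Implicit Defensive.
Import Order.TTheory GRing.Theory Num.Theory.
Import numFieldNormedType.Exports.
Local Open Scope classical_set_scope.
Local Open Scope ring_scope.

(* Throughout, the space dimension is d = n.+1 >= 1 and points are row vectors. *)

Section Euclidean.
Context {R : realType} {n : nat}.
Implicit Types (x y : 'rV[R]_n.+1) (A : set 'rV[R]_n.+1).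

Definition dotv x y : R := \sum_i x 0 i * y 0 i.

Definition dot1 (a b : R) : R := a * b.

Definition enorm x : R := Num.sqrt (dotv x x).

(* sup of an empty family is -oo, but only nonempty sets are measured below *)
Definition diam A : \bar R :=
  ereal_sup [set (enorm (p.1 - p.2))%:E | p in A `*` A].

Definition bnd A : set 'rV[R]_n.+1 := closure A `\` interior A.

End Euclidean.

(* Outer measures obtained from a gauge by countable coverings: [mu_ext] takes
   the infimum of \sum_k tau (F k) over the coverings of X by measurable F k,
   and every subset of [allsets T] is measurable. *)
Section Covering.

Definition allsets (T : Type) : Type := T.
Context (T : pointedType).
HB.instance Definition _ := Pointed.on (allsets T).
HB.instance Definition _ := @isMeasurable.Build default_measure_display
  (allsets T) setT I (fun _ _ => I) (fun _ _ => I).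

Definition covering (R : realType) (tau : set T -> \bar R) : set T -> \bar R :=
  @mu_ext _ (allsets T) R tau.

End Covering.

Section Lebesgue.
Context (R : realType) (n : nat).
Local Notation pt := 'rV[R]_n.+1.
Local Open Scope ereal_scope.

(* least volume of a box with sides parallel to the axes containing A *)
Definition box_gauge (A : set pt) : \bar R :=
  ereal_inf [set (\prod_i (p.2 0 i - p.1 0 i)%R)%:E | p in
    [set p : pt * pt | (forall i, (p.1 0 i <= p.2 0 i)%R) /\
      A `<=` [set x | forall i, (p.1 0 i <= x 0 i <= p.2 0 i)%R]]].

Lemma box_gauge_ge0 A : 0 <= box_gauge A.
Proof.
apply: le_ereal_inf_tmp => _ [p [p12 _] <-]; rewrite lee_fin.
by apply: prodr_ge0 => i _; rewrite subr_ge0.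
Qed.

Lemma box_gauge0 : box_gauge set0 = 0.
Proof.
apply/eqP; rewrite eq_le box_gauge_ge0 andbT; apply: ereal_inf_lbound.
exists (0%R, 0%R) => /=; first by split=> // i; rewrite lexx.
by congr _%:E; rewrite big_ord_recl subrr mul0r.
Qed.

Definition leb_outer : set pt -> \bar R := covering box_gauge.

HB.instance Definition _ := isOuterMeasure.Build R pt leb_outer
  (@mu_ext0 _ (allsets pt) R _ box_gauge0 box_gauge_ge0)
  (mu_ext_ge0 (T := allsets pt) box_gauge_ge0)
  (le_mu_ext (T := allsets pt) box_gauge)
  (mu_ext_sigma_subadditive (T := allsets pt) box_gauge_ge0).

(* Lebesgue measure on the (complete) sigma-algebra of Lebesgue measurable sets *)
Definition leb : {measure set (caratheodory_type leb_outer) -> \bar R} :=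
  OuterMeasure.sort leb_outer.

End Lebesgue.

(* The Hausdorff measure of dimension n = d - 1, without the normalising
   constant: only null sets and L^1 convergence are used. *)
Section Hausdorff.
Context (R : realType) (n : nat).
Local Notation pt := 'rV[R]_n.+1.
Local Open Scope ereal_scope.

Definition diam_gauge (delta : R) (A : set pt) : \bar R :=
  if `[< A = set0 >] then 0
  else if diam A <= delta%:E then diam A ^+ n else +oo.

Lemma diam_gauge_ge0 delta A : 0 <= diam_gauge delta A.
Proof.
rewrite /diam_gauge; case: asboolP => // /eqP/set0P[x Ax].
case: ifP => // _; apply: expe_ge0; apply: ereal_sup_ubound.
by exists (x, x) => //=; rewrite subrr /enorm /dotv big1 ?sqrtr0// => i _;
  rewrite mxE mul0r.
Qed.

Lemma diam_gauge0 delta : diam_gauge delta set0 = 0.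
Proof. by rewrite /diam_gauge; case: asboolP. Qed.

Definition hausdorff_outer (X : set pt) : \bar R :=
  ereal_sup [set covering (diam_gauge delta) X | delta in [set e | (0 < e)%R]].

Let cov_ge0 delta X : 0 <= covering (diam_gauge delta) X.
Proof. exact: (mu_ext_ge0 (T := allsets pt) (diam_gauge_ge0 delta)). Qed.

Let hausdorff_ge0 X : 0 <= hausdorff_outer X.
Proof.
apply: (le_trans (cov_ge0 1 X)); apply: ereal_sup_ubound.
by exists 1%R => //=.
Qed.

Let hausdorff0 : hausdorff_outer set0 = 0.
Proof.
apply/eqP; rewrite eq_le hausdorff_ge0 andbT; apply: ge_ereal_sup => _ [e _ <-].
by rewrite /covering mu_ext0//; [exact: diam_gauge0|exact: diam_gauge_ge0].
Qed.

Let hausdorff_le : {homo hausdorff_outer : A B / A `<=` B >-> A <= B}.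
Proof.
move=> A B AB; apply: ge_ereal_sup => _ [e e0 <-].
apply: (@le_trans _ _ (covering (diam_gauge e) B)).
  exact: (le_mu_ext (T := allsets pt)).
by apply: ereal_sup_ubound; exists e.
Qed.

Let hausdorff_subadd : sigma_subadditive hausdorff_outer.
Proof.
move=> F; apply: ge_ereal_sup => _ [e e0 <-].
apply: (le_trans (mu_ext_sigma_subadditive (T := allsets pt)
  (diam_gauge_ge0 e) F)).
apply: lee_nneseries => [k _ _|k _]; first exact: cov_ge0.
by apply: ereal_sup_ubound; exists e.
Qed.

HB.instance Definition _ := isOuterMeasure.Build R pt hausdorff_outer
  hausdorff0 hausdorff_ge0 hausdorff_le hausdorff_subadd.

Definition surface : {measure set (caratheodory_type hausdorff_outer) -> \bar R} :=
  OuterMeasure.sort hausdorff_outer.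

End Hausdorff.

Section Domains.
Context {R : realType} {n : nat}.
Local Notation pt := 'rV[R]_n.+1.
Implicit Types (Omega T : set pt) (Th : set (set pt)).

(* Near each boundary point, Omega lies below the graph, in some unit direction
   e, of a Lipschitz function of the projection onto the orthogonal of e. *)
Definition lipschitz_boundary Omega :=
  forall p, bnd Omega p -> exists (e : pt) (r L : R) (gamma : pt -> R),
    [/\ dotv e e = 1, 0 < r, L.-lipschitz gamma &
      forall y, enorm (y - p) < r ->
        (Omega y <-> dotv y e < gamma (y - dotv y e *: e))].

Definition bounded_lipschitz_domain Omega :=
  [/\ open Omega, connected Omega, Omega !=set0, bounded_set Omega
    & lipschitz_boundary Omega].

Definition relatively_open_in (B G : set pt) :=
  exists2 U : set pt, open U & G = U `&` B.

Definition boundary_splitting Omega GammaD GammaN :=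
  [/\ relatively_open_in (bnd Omega) GammaD,
      relatively_open_in (bnd Omega) GammaN,
      GammaD `&` GammaN = set0 &
      surface R n (bnd Omega `\` (GammaD `|` GammaN)) = 0%E].

Definition affine_indep (p : 'I_n.+2 -> pt) :=
  forall l : 'I_n.+2 -> R, \sum_i l i = 0 -> \sum_i l i *: p i = 0 ->
    forall i, l i = 0.

Definition open_simplex (p : 'I_n.+2 -> pt) : set pt :=
  [set x | exists l : 'I_n.+2 -> R,
    [/\ forall i, 0 < l i, \sum_i l i = 1 & x = \sum_i l i *: p i]].

(* the face spanned by the vertices p i, i in J; empty when J is *)
Definition closed_face (p : 'I_n.+2 -> pt) (J : {set 'I_n.+2}) : set pt :=
  [set x | exists l : 'I_n.+2 -> R,
    [/\ forall i, 0 <= l i, forall i, i \notin J -> l i = 0,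
        \sum_i l i = 1 & x = \sum_i l i *: p i]].

Definition is_face (F T : set pt) :=
  exists p J, [/\ affine_indep p, T = open_simplex p & F = closed_face p J].

(* The elements are taken to be open simplices, so that they lie in Omega. *)
Definition conforming_triangulation Omega Th :=
  [/\ finite_set Th,
      forall T, Th T -> exists2 p, affine_indep p & T = open_simplex p,
      forall T, Th T -> T `<=` Omega,
      closure Omega = \bigcup_(T in Th) closure T &
      forall T T', Th T -> Th T' -> T <> T' ->
        is_face (closure T `&` closure T') T /\
        is_face (closure T `&` closure T') T'].

Definition inradius T : \bar R :=
  ereal_sup [set rho%:E | rho in
    [set rho | exists x : pt, [set y | enorm (y - x) < rho] `<=` T]].

Definition shape_regular (sigma : R) Th :=
  forall T, Th T -> (diam T <= sigma%:E * inradius T)%E.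

End Domains.

Section Sobolev.
Context {R : realType} {n : nat}.
Local Notation pt := 'rV[R]_n.+1.
Variable Omega : set pt.
Implicit Types (p : \bar R) (v w eta : pt -> R) (r : pt -> pt).

Definition partial (i : 'I_n.+1) eta : pt -> R := fun x => 'D_('e_i) eta x.

Fixpoint partials (l : seq 'I_n.+1) eta : pt -> R :=
  if l is i :: l' then partial i (partials l' eta) else eta.

Definition smooth eta := forall l : seq 'I_n.+1,
  continuous (partials l eta) /\
  forall (i : 'I_n.+1) x, derivable (partials l eta) x 'e_i.

Definition test_function eta := smooth eta /\
  exists K : set pt, [/\ compact K, K `<=` Omega & forall x, ~ K x -> eta x = 0].

Definition Lp p v := (v \_ Omega : caratheodory_type (@leb_outer R n) -> R)
  \in Lfun (leb R n) p.

Definition Lpv p r := forall i, Lp p (fun x => r x 0 i).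

Definition L1loc v := forall K : set pt, compact K -> K `<=` Omega ->
  (leb R n).-integrable K (EFin \o v).

Definition is_weak_grad v (g : pt -> pt) :=
  forall i, L1loc (fun x => g x 0 i) /\
    forall eta, test_function eta ->
      (\int[leb R n]_(x in Omega) (v x * partial i eta x)%:E =
       - \int[leb R n]_(x in Omega) (g x 0 i * eta x)%:E)%E.

(* a representative of the weak gradient, junk if there is none *)
Definition wgrad v : pt -> pt := xget (fun=> 0) [set g | is_weak_grad v g].

Definition is_weak_div r (z : pt -> R) := L1loc z /\
  forall eta, test_function eta ->
    (\int[leb R n]_(x in Omega) (\sum_i r x 0 i * partial i eta x)%R%:E =
     - \int[leb R n]_(x in Omega) (z x * eta x)%:E)%E.

Definition wdiv r : pt -> R := xget (fun=> 0) [set z | is_weak_div r z].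

Definition W1 p v :=
  [/\ Lp p v, is_weak_grad v (wgrad v) & Lpv p (wgrad v)].

(* The trace W^{1,1}(Omega) -> L^1(bnd Omega) extends by continuity the
   restriction to bnd Omega of functions that are smooth up to the boundary. *)
Definition is_trace v (g : pt -> R) :=
  measurable_fun (bnd Omega : set (caratheodory_type (@hausdorff_outer R n))) g /\
  exists w : nat -> pt -> R,
    [/\ forall k, smooth (w k),
        (fun k => \int[leb R n]_(x in Omega) `|v x - w k x|%:E)%E @ \oo --> 0%E,
        forall i, (fun k => \int[leb R n]_(x in Omega)
          `|wgrad v x 0 i - partial i (w k) x|%:E)%E @ \oo --> 0%E &
        (fun k => \int[surface R n]_(x in bnd Omega) `|w k x - g x|%:E)%E
          @ \oo --> 0%E].

Definition zero_trace (Gamma : set pt) v := exists2 g, is_trace v g &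
  {ae surface R n, forall x, Gamma x -> g x = 0}.

Definition W1D (GammaD : set pt) p v := W1 p v /\ zero_trace GammaD v.

Definition W1Ndiv (GammaD : set pt) r :=
  [/\ Lpv 1 r, is_weak_div r (wdiv r), Lp 1 (wdiv r) &
    forall w, W1D GammaD +oo w ->
      (\int[leb R n]_(x in Omega)
         (dotv (r x) (wgrad w x) + w x * wdiv r x)%:E = 0)%E].

End Sobolev.

(* Convex analysis on a space V identified with its dual by the pairing [dot]. *)
Section Convex.
Context {R : realType} {V : normedModType R} (dot : V -> V -> R).
Local Open Scope ereal_scope.
Implicit Types (h : V -> \bar R) (a b s : V).

Definition proper_fun h := (forall a, h a != -oo) /\ exists a, h a < +oo.

Definition cvx h := forall a b (t : R), (0 < t < 1)%R ->
  h (t *: a + (1 - t) *: b)%R <= t%:E * h a + (1 - t)%:E * h b.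

Definition epi h : set (V * R)%type := [set z | h z.1 <= z.2%:E].

Definition conjugate h : V -> \bar R :=
  fun s => ereal_sup [set (dot s a)%:E - h a | a in [set: V]].

Definition effdom h : set V := [set a | h a < +oo].

Definition subdiff h a : set V := [set s | h a \is a fin_num /\
  forall b, h a + (dot s (b - a)%R)%:E <= h b].

Definition effdom_subdiff h : set V := [set a | subdiff h a !=set0].

(* meaningful for s in subdiff h b; then h b is finite *)
Definition bregman h s a b : \bar R := h a - h b - (dot s (a - b)%R)%:E.

Definition bregman_young (c : R) h :=
  forall a1 a2 r1 r2, effdom h a1 -> effdom_subdiff h a2 ->
    effdom (conjugate h) r1 -> effdom_subdiff (conjugate h) r2 -> subdiff (conjugate h) r2 a2 ->
  forall p b, subdiff h a2 p -> subdiff (conjugate h) r2 b ->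
    `|dot (a1 - a2)%R (r1 - r2)%R|%:E <=
      c%:E * (bregman h p a1 a2 + bregman (conjugate h) b r1 r2).

End Convex.

Section Integrands.
Context {R : realType} {n : nat} {V : normedModType R}.
Local Notation pt := 'rV[R]_n.+1.
Variable Omega : set pt.

Definition normal_convex_integrand (f : pt -> V -> \bar R) :=
  (forall x, Omega x -> [/\ proper_fun (f x), cvx (f x) & closed (epi (f x))]) /\
  forall O : set (V * R)%type, open O ->
    (@leb_outer R n).-cara.-measurable
      (Omega `&` [set x | epi (f x) `&` O !=set0]).

Definition integrand_bregman_young (dot : V -> V -> R) (c : R)
    (f : pt -> V -> \bar R) :=
  {ae leb R n, forall x, Omega x -> bregman_young dot c (f x)}.

End Integrands.

Section Energies.
Context {R : realType} {n : nat}.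
Local Notation pt := 'rV[R]_n.+1.
Variables (Omega GammaD : set pt).
Variables (phi : pt -> pt -> \bar R) (psi : pt -> R -> \bar R).
Local Open Scope ereal_scope.

Definition phis x := conjugate dotv (phi x).
Definition psis x := conjugate dot1 (psi x).

(* Integral functionals of convex analysis: +oo prevails in +oo - oo, which is
   the addition of the scope %dE. *)
Definition integral_functional (f : pt -> \bar R) : \bar R :=
  (\int[leb R n]_(x in Omega) (f^\+ x) -
   \int[leb R n]_(x in Omega) (f^\- x))%dE.

Definition primal (v : pt -> R) : \bar R :=
  (integral_functional (fun x => phi x (wgrad Omega v x)) +
   integral_functional (fun x => psi x (v x)))%dE.

Definition dual (r : pt -> pt) : \bar R :=
  - (integral_functional (fun x => phis x (r x)) +
     integral_functional (fun x => psis x (wdiv Omega r x)))%dE.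

Definition strong_duality (u : pt -> R) (q : pt -> pt) :=
  [/\ W1D Omega GammaD 1 u /\
        (forall v, W1D Omega GammaD 1 v -> primal u <= primal v),
      primal u < +oo,
      W1Ndiv Omega GammaD q /\
        (forall r, W1Ndiv Omega GammaD r -> dual r <= dual q),
      -oo < dual q
    & primal u = dual q].

(* For u in W^{1,1} and q, div q merely in L^1 the identity
   \int (q . grad u + u div q) = 0 is not part of the definition of W1Ndiv (its
   test functions are in W^{1,oo}), so these relations, which accompany strong
   duality and make the subgradients in [bregman_sum] admissible, are stated on
   their own. *)
Definition optimality_relations (u : pt -> R) (q : pt -> pt) :=
  {ae leb R n, forall x, Omega x ->
    (dotv (q x) (wgrad Omega u x))%:E =
      phi x (wgrad Omega u x) + phis x (q x) /\
    (u x * wdiv Omega q x)%:E = psi x (u x) + psis x (wdiv Omega q x)}.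

(* the square of the local gap estimator *)
Definition gap2 (T : set pt) (v : pt -> R) (r : pt -> pt) : \bar R :=
  \int[leb R n]_(x in T)
    (phi x (wgrad Omega v x) - (dotv (r x) (wgrad Omega v x))%:E
     + phis x (r x)) +
  \int[leb R n]_(x in T)
    (psi x (v x) - (v x * wdiv Omega r x)%:E + psis x (wdiv Omega r x)).

Definition bregman_sum (u : pt -> R) (q : pt -> pt) (v : pt -> R)
    (r : pt -> pt) (x : pt) : \bar R :=
  bregman dotv (phi x) (q x) (wgrad Omega v x) (wgrad Omega u x)
  + bregman dot1 (psi x) (wdiv Omega q x) (v x) (u x)
  + bregman dotv (phis x) (wgrad Omega u x) (r x) (q x)
  + bregman dot1 (psis x) (u x) (wdiv Omega r x) (wdiv Omega q x).

End Energies.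

(* Main.v *)
Require Import Defs.
From mathcomp Require Import all_boot all_order all_algebra.
From mathcomp Require Import all_classical all_reals all_analysis.
From mathcomp Require Import measurable_realfun lra.
Import Order.TTheory GRing.Theory Num.Theory.
Import numFieldNormedType.Exports.
Import HBNNSimple.
Local Open Scope classical_set_scope.
Local Open Scope ring_scope.

(** The two parts of the estimator are handled in the same way, pointwise.  Let
    [h] be the integrand at a point, [a2] and [r2] the values of the primal and
    the dual solution there, so that [r2 . a2 = h a2 + h* r2], and let [a1], [r1]
    be the values of the competitors.  Expanding the definitions gives
      [h a1 - r1 . a1 + h* r1
         = D_h (a1, a2) + D_h* (r1, r2) - (a1 - a2) . (r1 - r2)],
    and the Bregman--Young inequality, applied with the subgradients [r2] of [h]
    and [a2] of [h*], bounds the last term by [c] times the sum of the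
    divergences.  Hence the gap is at most [1 + c] times this sum; this is
    [gap_le_bregman], and [C = 1 + c].

    It remains to integrate over the element.  Both sides involve compositions
    with the integrands whose measurability would need the theory of normal
    integrands.  It can be bypassed: the integral of a nonnegative function is
    the supremum of the integrals of the simple functions below it, and this
    lower integral is monotone almost everywhere, homogeneous and superadditive
    for arbitrary nonnegative functions.  As the sum of two integrals is on the
    smaller side of the estimate, superadditivity suffices; this is
    [integral_superD_ae]. *)

(** * The integral of arbitrary nonnegative functions *)

Section lower_integral.
Context {d : measure_display} {T : measurableType d} {R : realType}.
Variable mu : {measure set T -> \bar R}.
Local Open Scope ereal_scope.
Implicit Types (D N A : set T) (f g : T -> \bar R) (h : {nnsfun T >-> R}).

Lemma sintegral_proj_conull {A} (mA : measurable A) h :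
  mu (~` A) = 0 -> sintegral mu (proj_nnsfun h mA) = sintegral mu h.
Proof.
move=> A0; rewrite -(integralT_nnsfun mu h).
rewrite (ge0_negligible_integral (N := ~` A))//; last first.
- by move=> x _; rewrite lee_fin.
- exact/measurable_EFinP.
- exact: measurableC.
by rewrite setTD setCK integral_nnsfun// mrestrict.
Qed.

Lemma sintegral_le_integral h g : (forall x, (h x)%:E <= g x) ->
  sintegral mu h <= \int[mu]_x g x.
Proof.
move=> hg; rewrite ge0_integralTE; first by apply: ereal_sup_ubound; exists h.
by move=> x; apply: le_trans (hg x); rewrite lee_fin.
Qed.

(** The function [(h1 + h2) / C], set to 0 on [N], is a simple function below
    [g] everywhere and has the same integral as [(h1 + h2) / C]. *)
Lemma sintegralD_le_integral h1 h2 g N (C : R) : (0 < C)%R ->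
  measurable N -> mu N = 0 -> (forall x, 0 <= g x) ->
  (forall x, ~ N x -> (h1 x)%:E + (h2 x)%:E <= C%:E * g x) ->
  sintegral mu h1 + sintegral mu h2 <= C%:E * \int[mu]_x g x.
Proof.
move=> C0 mN N0 g0 hg; have Ci0 : (0 <= C^-1)%R by rewrite invr_ge0 ltW.
have mA : measurable (~` N) by exact: measurableC.
pose h := scale_nnsfun (proj_nnsfun (add_nnsfun h1 h2) mA) Ci0.
have hE : sintegral mu h = (C^-1)%:E * (sintegral mu h1 + sintegral mu h2).
  rewrite (sintegralrM mu C^-1%R (proj_nnsfun (add_nnsfun h1 h2) mA)).
  by rewrite sintegral_proj_conull ?setCK// sintegralD.
have : sintegral mu h <= \int[mu]_x g x.
  apply: sintegral_le_integral => x /=.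
  rewrite mindicE; case: (boolP (x \in ~` N)) => [|_]; last by rewrite !mulr0.
  rewrite inE/= mulr1 => /hg; rewrite -EFinD EFinM.
  by rewrite lee_pdivrMl.
by rewrite hE lee_pdivrMl.
Qed.

(** Take the supremum over the simple functions below [f2], then over those below
    [f1].  Only superadditivity holds without measurability: a simple function
    below [f1 + f2] need not split into parts below [f1] and [f2]. *)
Lemma ge0_integral_superD f1 f2 g N (C : R) : (0 < C)%R ->
  measurable N -> mu N = 0 ->
  (forall x, 0 <= f1 x) -> (forall x, 0 <= f2 x) -> (forall x, 0 <= g x) ->
  (forall x, ~ N x -> f1 x + f2 x <= C%:E * g x) ->
  \int[mu]_x f1 x + \int[mu]_x f2 x <= C%:E * \int[mu]_x g x.
Proof.
move=> C0 mN N0 f10 f20 g0 fg; set I := _ * _.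
have I0 : 0 <= I by rewrite mule_ge0 ?integral_ge0// lee_fin ltW.
have [Ioo|/= Ifin] := eqVneq I +oo; first by rewrite Ioo leey.
have {}Ifin : I \is a fin_num by rewrite ge0_fin_numE// ltey.
(* The right-hand side is finite from here on, so that it bounds both suprema
   by finite numbers and subtraction is available. *)
have step h1 h2 : (forall x, (h1 x)%:E <= f1 x) ->
    (forall x, (h2 x)%:E <= f2 x) -> sintegral mu h1 + sintegral mu h2 <= I.
  move=> hf1 hf2; apply: (@sintegralD_le_integral _ _ _ N) => // x Nx.
  exact: le_trans (leeD (hf1 x) (hf2 x)) (fg x Nx).
have fin h : sintegral mu h <= I -> sintegral mu h \is a fin_num.
  move=> hI; rewrite ge0_fin_numE ?sintegral_ge0//.
  by rewrite (le_lt_trans hI)// ltey_eq Ifin.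
have step2 h1 : (forall x, (h1 x)%:E <= f1 x) ->
    sintegral mu h1 + \int[mu]_x f2 x <= I.
  move=> hf1; have h1fin : sintegral mu h1 \is a fin_num.
    apply: fin; have := step h1 nnsfun0 hf1.
    by rewrite sintegral0 adde0; apply => x /=; exact: f20.
  rewrite addeC -leeBrDr//.
  rewrite ge0_integralTE//; apply: ge_ereal_sup => _ [h2 hf2 <-].
  by rewrite leeBrDr// addeC step.
have f2fin : \int[mu]_x f2 x \is a fin_num.
  rewrite ge0_fin_numE ?integral_ge0//.
  apply: (@le_lt_trans _ _ I); last by rewrite ltey_eq Ifin.
  by have := step2 nnsfun0; rewrite sintegral0 add0e; apply => x /=; exact: f10.
rewrite -leeBrDr//.
rewrite ge0_integralTE//; apply: ge_ereal_sup => _ [h1 hf1 <-].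
by rewrite leeBrDr// step2.
Qed.

(** On the exceptional null set the functions may be negative, which brings in
    their negative parts.  Those of [f1] and [f2] only lower the left-hand side;
    that of [g] vanishes almost everywhere, so its integral is 0. *)
Lemma integral_superD_ae D f1 f2 g (C : R) : (0 < C)%R ->
  {ae mu, forall x, D x ->
    [/\ 0 <= f1 x, 0 <= f2 x & f1 x + f2 x <= C%:E * g x]} ->
  \int[mu]_(x in D) f1 x + \int[mu]_(x in D) f2 x
    <= C%:E * \int[mu]_(x in D) g x.
Proof.
move=> C0 [N [mN N0 /subsetCl subN]].
have g_ge0 x : ~ N x -> D x -> 0 <= g x.
  move=> /subN/= + Dx => /(_ Dx)[f10 f20 fg].
  by rewrite -(pmule_rge0 (g x) (_ : 0 < C%:E))// (le_trans _ fg)// adde_ge0.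
have le_pos f : \int[mu]_(x in D) f x <= \int[mu]_x (f \_ D)^\+ x.
  by rewrite integral_mkcond integralE geeDl ?oppe_le0 ?integral_ge0//.
have gpos : \int[mu]_(x in D) g x = \int[mu]_x (g \_ D)^\+ x.
  rewrite integral_mkcond integralE; set J := (X in _ - X).
  suff -> : J = 0 by rewrite sube0.
  apply/eqP; rewrite eq_le integral_ge0// andbT.
  (* The negative part of [g] is dominated by 0 off [N]. *)
  have := @ge0_integral_superD (g \_ D)^\- (cst 0) (cst 0) N 1 ltr01 mN N0.
  rewrite integral0 mul1e adde0; apply => // x Nx.
  rewrite /= adde0 funenegE ge_max lexx andbT leeNl oppe0 patchE.
  by case: ifPn => //; rewrite inE; exact: g_ge0.
rewrite gpos (le_trans (leeD (le_pos f1) (le_pos f2)))//.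
apply: (@ge0_integral_superD _ _ _ N) => // x Nx.
rewrite !funeposE !patchE; case: ifPn => [|_]; last by rewrite maxxx adde0 mule0.
rewrite inE => Dx; have [f10 f20 fg] := subN _ Nx Dx.
by rewrite !max_l// g_ge0.
Qed.

End lower_integral.

(** * The pointwise gap and the Bregman divergences *)

Section bregman_gap.
Context {R : realType} {V : normedModType R} (dot : V -> V -> R).
Hypothesis dotC : forall x y, dot x y = dot y x.
Hypothesis dotBl : forall x y z, dot (x - y) z = dot x z - dot y z.
Local Open Scope ereal_scope.
Implicit Types (h : V -> \bar R) (a r : V).

Lemma dotBr x y z : dot x (y - z)%R = (dot x y - dot x z)%R.
Proof. by rewrite dotC dotBl !(dotC x). Qed.

Lemma fenchel_young h a r : (dot r a)%:E - h a <= conjugate dot h r.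
Proof. by apply: ereal_sup_ubound; exists a. Qed.

Lemma conjugate_gtNy h r : proper_fun h -> conjugate dot h r != -oo.
Proof.
move=> [hNy [a ha]]; rewrite -ltNye (lt_le_trans _ (fenchel_young h a r))//.
by move: (hNy a) ha; case: (h a) => [x _ _|_|]//; exact: ltNyr.
Qed.

(** If all four values of [h] and [h*] are finite, this is the identity
    [gap = breg - (a1 - a2) . (r1 - r2)] followed by the Bregman--Young
    inequality.  Otherwise [h a1] or [h* r1] is [+oo], and so is [breg], because
    the other divergence is nonnegative.  Equality in the Fenchel--Young
    inequality at [(a2, r2)] makes [h a2] and [h* r2] finite and gives both
    subgradient inclusions. *)
Lemma gap_le_bregman h c a1 a2 r1 r2 : (0 <= c)%R -> proper_fun h ->
  bregman_young dot c h ->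
  (dot r2 a2)%:E = h a2 + conjugate dot h r2 ->
  let gap := h a1 - (dot r1 a1)%:E + conjugate dot h r1 in
  let breg := bregman dot h r2 a1 a2 + bregman dot (conjugate dot h) a2 r1 r2 in
  [/\ 0 <= gap, 0 <= bregman dot h r2 a1 a2,
      0 <= bregman dot (conjugate dot h) a2 r1 r2 &
      gap <= (1 + c)%:E * breg].
Proof.
move=> c0 ph hBY eq2 gap breg.
have [hNy _] := ph; have hsNy r := conjugate_gtNy h r ph.
have FY a r := fenchel_young h a r.
have {hNy}hNy a := hNy a.
have [ha2 hr2] : h a2 \is a fin_num /\ conjugate dot h r2 \is a fin_num.
  by move: eq2 (hNy a2) (hsNy r2); case: (h a2); case: (conjugate dot h r2).
have sr2 : subdiff dot h a2 r2.
  split=> // b; move: (FY b r2) eq2 (hNy b); rewrite dotBr.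
  move: ha2 hr2; case: (h a2) => //= x; case: (conjugate dot h r2) => //= y _ _.
  case: (h b) => [z||]//=; last by rewrite leey.
  by rewrite !lee_fin => + [->] _; lra.
have sa2 : subdiff dot (conjugate dot h) r2 a2.
  split=> // r; move: (FY a2 r) eq2 (hsNy r); rewrite dotBr !(dotC a2).
  move: ha2 hr2; case: (h a2) => //= x; case: (conjugate dot h r2) => //= y _ _.
  case: (conjugate dot h r) => [z||]//=; last by move=> *; exact: leey.
  by rewrite !lee_fin => + [->] _; lra.
have D0 : 0 <= bregman dot h r2 a1 a2.
  move: (sr2.2 a1) ha2; rewrite /bregman; case: (h a2) => //= x + _.
  case: (h a1) => [y||]//=; last by move=> *; exact: leey.
  by rewrite !lee_fin; lra.
have Ds0 : 0 <= bregman dot (conjugate dot h) a2 r1 r2.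
  move: (sa2.2 r1) hr2; rewrite /bregman; case: (conjugate dot h r2) => //= x + _.
  case: (conjugate dot h r1) => [y||]//=; last by move=> *; exact: leey.
  by rewrite !lee_fin; lra.
have gap0 : 0 <= gap.
  move: (FY a1 r1) (hNy a1) (hsNy r1); rewrite /gap.
  case: (h a1) => [x||]//; case: (conjugate dot h r1) => [y||]// + _ _;
    by [rewrite !lee_fin; lra | move=> _; exact: leey].
split=> //.
have [a1oo|a1fin] := eqVneq (h a1) +oo.
  suff -> : breg = +oo by rewrite gt0_muley ?leey// lte_fin; lra.
  rewrite /breg; have -> : bregman dot h r2 a1 a2 = +oo.
    by rewrite /bregman a1oo; move: ha2; case: (h a2).
  by rewrite addye// -ltNye (lt_le_trans _ Ds0).
have [r1oo|r1fin] := eqVneq (conjugate dot h r1) +oo.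
  suff -> : breg = +oo by rewrite gt0_muley ?leey// lte_fin; lra.
  rewrite /breg; have -> : bregman dot (conjugate dot h) a2 r1 r2 = +oo.
    by rewrite /bregman r1oo; move: hr2; case: (conjugate dot h r2).
  by rewrite addey// -ltNye (lt_le_trans _ D0).
have := hBY a1 a2 r1 r2 _ _ _ _ sa2 r2 a2 sr2 sa2.
rewrite /effdom/= !ltey => /(_ a1fin (ex_intro _ _ sr2) r1fin (ex_intro _ _ sa2)).
move: eq2 ha2 hr2 (hNy a1) (hsNy r1) a1fin r1fin.
rewrite /breg /gap /bregman dotBl !dotBr !(dotC a1) !(dotC a2).
case: (h a2) => // x; case: (conjugate dot h r2) => // y.
case: (h a1) => // z; case: (conjugate dot h r1) => // t.
move=> [e2] _ _ _ _ _ _.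
rewrite -!EFinN -!EFinD -!EFinM !lee_fin mulrDl mul1r.
by rewrite -normrN => /(le_trans (ler_norm _)); lra.
Qed.

End bregman_gap.

(** * The local gap estimate *)

Lemma dotvC {R : realType} {n : nat} (x y : 'rV[R]_n.+1) : dotv x y = dotv y x.
Proof. by apply: eq_bigr => i _; rewrite mulrC. Qed.

Lemma dotvBl {R : realType} {n : nat} (x y z : 'rV[R]_n.+1) :
  dotv (x - y) z = dotv x z - dotv y z.
Proof.
by rewrite /dotv -sumrB; apply: eq_bigr => i _; rewrite !mxE mulrBl.
Qed.

Theorem theorem3p2 (R : realType) (c : R) (c_gt0 : 0 < c) :
  exists C : R, 0 < C /\
    forall (n : nat) (Omega GammaD GammaN : set 'rV[R]_n.+1)
      (sigma : R) (Th : set (set 'rV[R]_n.+1))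
      (phi : 'rV[R]_n.+1 -> 'rV[R]_n.+1 -> \bar R)
      (psi : 'rV[R]_n.+1 -> R -> \bar R)
      (u : 'rV[R]_n.+1 -> R) (q : 'rV[R]_n.+1 -> 'rV[R]_n.+1),
    bounded_lipschitz_domain Omega ->
    boundary_splitting Omega GammaD GammaN ->
    conforming_triangulation Omega Th ->
    shape_regular sigma Th ->
    normal_convex_integrand Omega phi ->
    normal_convex_integrand Omega psi ->
    strong_duality Omega GammaD phi psi u q ->
    optimality_relations Omega phi psi u q ->
    integrand_bregman_young Omega dotv c phi ->
    integrand_bregman_young Omega dot1 c psi ->
    forall (v : 'rV[R]_n.+1 -> R) (r : 'rV[R]_n.+1 -> 'rV[R]_n.+1)
      (T : set 'rV[R]_n.+1),
    W1D Omega GammaD 1 v -> W1Ndiv Omega GammaD r -> Th T ->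
    (gap2 Omega phi psi T v r <=
      C%:E * \int[@leb R n]_(x in T) bregman_sum Omega phi psi u q v r x)%E.
Proof.
exists (1 + c); split; first lra.
move=> n Omega GammaD GammaN sigma Th phi psi u q _ _ [_ _ ThOmega _ _] _.
move=> [phi_cvx _] [psi_cvx _] _ opt BYphi BYpsi v r T _ _ /ThOmega TOmega.
rewrite /gap2; apply: integral_superD_ae; first lra.
have aeF := ae_filter_ringOfSetsType (leb R n).
apply: filterS3 opt BYphi BYpsi => x opt BYphi BYpsi /TOmega Ox.
have [eqphi eqpsi] := opt Ox.
have [properphi _ _] := phi_cvx x Ox; have [properpsi _ _] := psi_cvx x Ox.
have [gap1 D1 Ds1 le1] := gap_le_bregman dotv dotvC dotvBl (phi x) c
  (wgrad Omega v x) _ (r x) _ (ltW c_gt0) properphi (BYphi Ox) eqphi.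
have [|gap2 D2 Ds2 le2] := gap_le_bregman dot1 (@mulrC R)
    (fun a b s => mulrBl s a b) (psi x) c
  (v x) (u x) (wdiv Omega r x) (wdiv Omega q x) (ltW c_gt0) properpsi (BYpsi Ox).
  by rewrite /dot1 mulrC.
rewrite (mulrC (v x)); split=> //.
rewrite /bregman_sum -[X in (_ <= _ * X)%E]addeA [X in (_ <= _ * X)%E]addeACA.
by rewrite ge0_muleDr; [exact: leeD|exact: adde_ge0..].
Qed.
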